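(* Let $\vec x,\vec y,\vec p,\vec q$ be four sequences of commuting indeterminates (indexed by $k\ge1$). For every $n\ge0$, $$\sum_{|w|=n}s_w(\vec p\mid\vec q)\,s_w(\vec x\mid\vec y)=\det D_n,$$ where the sum is over all Fibonacci words of weight $n$, and $D_n$ is the $n\times n$ quadridiagonal matrix with $(k,k)$ entry $p_kx_k$, $(k,k+1)$ entry $q_k(x_kx_{k+1}-y_k)+y_k(p_kp_{k+1}-q_k)$, $(k,k+2)$ entry $p_kx_kq_{k+1}y_{k+1}$, $(k+1,k)$ entry $1$, and all other entries $0$.
   Context: A Fibonacci word is a finite (possibly empty) word $w$ in the letters $1,2$; its weight $|w|$ is the sum of its letters. For sequences $\vec x,\vec y$: $A_\ell$ ($A_0=1$) is the determinant of the $\ell\times\ell$ tridiagonal matrix with diagonal $x_1,\ldots,x_\ell$, superdiagonal $y_1,\ldots,y_{\ell-1}$ and subdiagonal entries $1$; $B_k(m)$ ($k,m\ge0$) is the determinant of the $(k+1)\times(k+1)$ tridiagonal matrix with diagonal $y_{m+1},x_{m+3},\ldots,x_{m+k+2}$, superdiagonal $x_{m+1}y_{m+2},y_{m+3},\ldots,y_{m+k+1}$, subdiagonal entries $1$. The clone Schur functions are $s_{1^k}(\vec x\mid\vec y)=A_k$, $s_{1^k2u}(\vec x\mid\vec y)=B_k(|u|)\,s_u(\vec x\mid\vec y)$; $s_w(\vec p\mid\vec q)$ is the same with $\vec x,\vec y$ replaced by $\vec p,\vec q$. *)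

(* Defs.v *)
From HB Require Import structures.
From mathcomp Require Import all_boot all_order all_algebra.

Set Implicit Arguments.
Unset Strict Implicit.
Unset Printing Implicit Defensive.

Import GRing.Theory.
Local Open Scope ring_scope.

Variant letter := One | Two.

Definition letter_val (a : letter) : nat :=
  match a with One => 1 | Two => 2 end.

Definition bool_of_letter (a : letter) : bool :=
  match a with One => false | Two => true end.
Definition letter_of_bool (b : bool) : letter := if b then Two else One.
Lemma bool_of_letterK : cancel bool_of_letter letter_of_bool.
Proof. by case. Qed.
HB.instance Definition _ := Finite.copy letter (can_type bool_of_letterK).

Definition weight (w : seq letter) : nat := sumn (map letter_val w).

(* Hence the words of weight [n] are exactly the elements of weight [n] of the
   finite type [n.-bseq letter]. *)
Lemma size_le_weight (w : seq letter) : (size w <= weight w)%N.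
Proof.
elim: w => //= a w IHw; rewrite /weight /= -add1n leq_add //.
by case: a.
Qed.

(* Matrix indices in ['I_n] start at 0. *)
Definition tridiag_mx (R : comNzRingType) (n : nat) (d e : nat -> R) : 'M[R]_n :=
  \matrix_(i < n, j < n)
    if j == i :> nat then d i
    else if j == i.+1 :> nat then e i
    else if i == j.+1 :> nat then 1
    else 0.

(* A sequence x_1, x_2, ... is a function [x : nat -> R] with [x k] = x_k; the
   value [x 0] is never used. *)
Definition cloneA (R : comNzRingType) (x y : nat -> R) (l : nat) : R :=
  \det (tridiag_mx l (fun i => x i.+1) (fun i => y i.+1)).

Definition cloneB (R : comNzRingType) (x y : nat -> R) (k m : nat) : R :=
  \det (tridiag_mx k.+1
    (fun i => if i == 0%N then y (m + 1)%N else x (m + i + 2)%N)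
    (fun i => if i == 0%N then x (m + 1)%N * y (m + 2)%N else y (m + i + 2)%N)).

(* [clone_schur_rec x y k w] is the clone Schur function of the word 1^k w. *)
Fixpoint clone_schur_rec (R : comNzRingType) (x y : nat -> R)
    (k : nat) (w : seq letter) : R :=
  match w with
  | [::] => cloneA x y k
  | One :: v => clone_schur_rec x y k.+1 v
  | Two :: u => cloneB x y k (weight u) * clone_schur_rec x y 0 u
  end.

Definition clone_schur (R : comNzRingType) (x y : nat -> R) (w : seq letter) : R :=
  clone_schur_rec x y 0 w.

Lemma clone_schur_rec_nseq (R : comNzRingType) (x y : nat -> R) j k w :
  clone_schur_rec x y j (nseq k One ++ w) = clone_schur_rec x y (k + j) w.
Proof. by elim: k j => //= k IHk j; rewrite IHk addnS. Qed.

Lemma clone_schur_ones (R : comNzRingType) (x y : nat -> R) k :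
  clone_schur x y (nseq k One) = cloneA x y k.
Proof. by rewrite /clone_schur -[nseq k One]cats0 clone_schur_rec_nseq addn0. Qed.

Lemma clone_schur_ones_two (R : comNzRingType) (x y : nat -> R) k u :
  clone_schur x y (nseq k One ++ Two :: u)
  = cloneB x y k (weight u) * clone_schur x y u.
Proof. by rewrite /clone_schur clone_schur_rec_nseq addn0. Qed.

(* Row [i] and column [j] of the matrix have 1-based indices [i.+1] and [j.+1]. *)
Definition cauchy_mx (R : comNzRingType) (x y p q : nat -> R) (n : nat) : 'M[R]_n :=
  \matrix_(i < n, j < n)
    let k := i.+1 in let l := j.+1 in
    if l == k then p k * x k
    else if l == k.+1 then
      q k * (x k * x k.+1 - y k) + y k * (p k * p k.+1 - q k)
    else if l == k.+2 then p k * x k * q k.+1 * y k.+1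
    else if k == l.+1 then 1
    else 0.

(* Main.v *)
(** Write [S n] for the sum over the words of weight [n]. A word is either [1^n]
    or [1^k 2 u], so [S n = A_n A'_n + \sum_m B_(n-2-m)(m) B'_(n-2-m)(m) S m].
    With the convention [B_(-1)(m) = x_(m+1)], the sequences [n |-> A_n] and
    [n |-> B_(n-2-m)(m)] all satisfy [u_n = x_n u_(n-1) - y_(n-1) u_(n-2)]. Hence
    the same sum with the factors [A'], [B'] taken one step behind [A], [B] obeys
    a recurrence that forces it to equal [x_n S (n-1)]; substituting this in the
    recurrence for the products [A A'], [B B'] gives for [S] the four-term
    recurrence of the determinant of a quadridiagonal Hessenberg matrix. *)
Require Import Defs.
From mathcomp Require Import all_boot all_order all_algebra.
From mathcomp Require Import ring zify.

Set Implicit Arguments.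
Unset Strict Implicit.
Unset Printing Implicit Defensive.

Import GRing.Theory.
Local Open Scope ring_scope.

(** * Determinants of quadridiagonal Hessenberg matrices *)

Section Hessenberg.

Variables (R : comNzRingType) (M : nat -> nat -> R).

Definition leading_minor n := \det (\matrix_(i < n, j < n) M i j).

(** A free last column closes the family under expansion along the last row: deleting the
    penultimate column leaves a minor of the same shape, one size smaller. *)
Definition last_col_minor n (c : nat -> R) :=
  \det (\matrix_(i < n.+1, j < n.+1) if j == n :> nat then c i else M i j).

Lemma leading_minor0 : leading_minor 0 = 1.
Proof. exact: det_mx00. Qed.

Lemma leading_minorS n : leading_minor n.+1 = last_col_minor n (M^~ n).
Proof.
by congr (\det _); apply/matrixP => i j; rewrite !mxE; case: eqP => // ->.
Qed.

Lemma last_col_minor_eq0 n c :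
  (forall i, (i <= n)%N -> c i = 0) -> last_col_minor n c = 0.
Proof.
move=> c0; rewrite /last_col_minor (expand_det_col _ ord_max) big1 // => i _.
by rewrite mxE eqxx c0 ?mul0r // -ltnS.
Qed.

Hypothesis M_sub : forall i, M i.+1 i = 1.
Hypothesis M_low : forall i j, (j.+1 < i)%N -> M i j = 0.

Lemma last_col_minorS n c :
  last_col_minor n.+1 c = c n.+1 * leading_minor n.+1 - last_col_minor n c.
Proof.
rewrite /last_col_minor (expand_det_row _ ord_max) !big_ord_recr /=.
rewrite big1 ?add0r => [|i _]; last first.
  by rewrite !mxE /= ifN ?M_low ?mul0r //; have := ltn_ord i; lia.
rewrite !mxE /= eqxx ifN ?M_sub ?mul1r; last by lia.
rewrite addrC; congr (_ + _).
  rewrite /cofactor /= addnn -signr_odd odd_double expr0 mul1r.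
  congr (_ * \det _); apply/matrixP => i j; rewrite !mxE !lift_max ifN //.
  by have := ltn_ord j; lia.
rewrite /cofactor /= addSn addnn -signr_odd /= odd_double expr1 mulN1r.
congr (- \det _); apply/matrixP => i j; rewrite !mxE lift_max /= /bump.
have [->|jn] := eqVneq (j : nat) n; first by rewrite leqnn eqxx.
have -> : (n <= j)%N = false by have := ltn_ord j; lia.
by rewrite add0n ifN //; have := ltn_ord j; lia.
Qed.

Hypothesis M_up : forall i j, (i.+2 < j)%N -> M i j = 0.

Lemma leading_minor_rec n :
  leading_minor n.+2 =
    M n.+1 n.+1 * leading_minor n.+1 - M n n.+1 * leading_minor n
    + (if n is m.+1 then M m n.+1 * leading_minor m else 0).
Proof.
have base c : last_col_minor 0 c = c 0 by rewrite /last_col_minor det_mx11 mxE.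
rewrite leading_minorS last_col_minorS -addrA; congr (_ + _).
case: n => [|n]; first by rewrite base leading_minor0 mulr1 addr0.
rewrite last_col_minorS opprB addrC; congr (_ + _).
case: n => [|n]; first by rewrite base leading_minor0 mulr1.
(* After three expansions, what remains of the last column lies above the second superdiagonal. *)
by rewrite last_col_minorS last_col_minor_eq0 ?subr0 // => i ?; rewrite M_up.
Qed.

End Hessenberg.

Lemma det_tridiag_mx_rec (R : comNzRingType) (d e : nat -> R) n :
  \det (tridiag_mx n.+2 d e) =
    d n.+1 * \det (tridiag_mx n.+1 d e) - e n * \det (tridiag_mx n d e).
Proof.
pose M i j := if j == i then d i else if j == i.+1 then e i
              else if i == j.+1 then 1 else 0.
have -> k : \det (tridiag_mx k d e) = leading_minor M k by [].
rewrite leading_minor_rec /M => [|i|i j ?|i j ?].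
- have -> : (n.+1 == n) = false by lia.
  rewrite !eqxx.
  case: n => [|n]; first by rewrite addr0.
  by rewrite !ifN ?mul0r ?addr0 //; lia.
- by rewrite eqxx !ifN //; lia.
- by rewrite !ifN //; lia.
- by rewrite !ifN //; lia.
Qed.

Lemma det_cauchy_mx_rec (R : comNzRingType) (x y p q : nat -> R) n :
  \det (cauchy_mx x y p q n.+2) =
    p n.+2 * x n.+2 * \det (cauchy_mx x y p q n.+1)
    - (q n.+1 * (x n.+1 * x n.+2 - y n.+1) + y n.+1 * (p n.+1 * p n.+2 - q n.+1))
      * \det (cauchy_mx x y p q n)
    + (if n is m.+1 then p n * x n * q n.+1 * y n.+1 * \det (cauchy_mx x y p q m)
       else 0).
Proof.
pose M i j := if j.+1 == i.+1 then p i.+1 * x i.+1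
  else if j.+1 == i.+2 then
    q i.+1 * (x i.+1 * x i.+2 - y i.+1) + y i.+1 * (p i.+1 * p i.+2 - q i.+1)
  else if j.+1 == i.+3 then p i.+1 * x i.+1 * q i.+2 * y i.+2
  else if i.+1 == j.+2 then 1 else 0.
have -> k : \det (cauchy_mx x y p q k) = leading_minor M k by [].
rewrite leading_minor_rec /M => [|i|i j ?|i j ?].
- have -> : (n.+2 == n.+1) = false by lia.
  rewrite !eqxx.
  by case: n => // n; rewrite 2?ifN ?eqxx //; lia.
- by rewrite eqxx !ifN //; lia.
- by rewrite !ifN //; lia.
- by rewrite !ifN //; lia.
Qed.

(** * Enumeration of the Fibonacci words of given weight *)

Fixpoint fib_words n : seq (seq letter) :=
  match n with
  | 0 => [:: [::]]
  | 1 => [:: [:: One]]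
  | (m.+1 as n').+1 => map (cons One) (fib_words n') ++ map (cons Two) (fib_words m)
  end.

Lemma fib_wordsSS n :
  fib_words n.+2 = map (cons One) (fib_words n.+1) ++ map (cons Two) (fib_words n).
Proof. by []. Qed.

Lemma mem_fib_words n w : (w \in fib_words n) = (weight w == n).
Proof.
have mem_cons a b v (s : seq (seq letter)) :
    (a :: v \in map (cons b) s) = (a == b) && (v \in s).
  apply/mapP/andP => [[u us [-> ->]]|[/eqP-> vs]]; first by rewrite eqxx.
  by exists v.
have nil_cons a (s : seq (seq letter)) : ([::] \in map (cons a) s) = false.
  by apply/mapP => -[].
have weight_cons a v : weight (a :: v) = (letter_val a + weight v)%N by [].
have weight0 v : (weight v == 0)%N = (v == [::]).
  by case: v => //= a v; rewrite weight_cons; case: a.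
elim/ltn_ind: n w => -[|[|n]] IHn w.
- by rewrite inE weight0.
- by rewrite inE; case: w => // -[] v; rewrite weight_cons eqseq_cons -weight0.
rewrite fib_wordsSS mem_cat; case: w => [|a v]; first by rewrite !nil_cons.
by rewrite !mem_cons !IHn // weight_cons; case: a; rewrite ?orbF.
Qed.

Lemma fib_words_uniq n : uniq (fib_words n).
Proof.
have cons_inj (a : letter) : injective (cons a) by move=> u v [].
elim/ltn_ind: n => -[|[|n]] IHn //.
rewrite fib_wordsSS cat_uniq !map_inj_uniq ?IHn // andbT /=.
by apply/hasPn => _ /mapP[u _ ->]; apply/mapP => -[].
Qed.

(** Passes to an enumeration by first letter, which allows recursion on the weight; by
    [size_le_weight] the length bound loses no word. *)
Lemma big_fib_words (R : comNzRingType) n (F : seq letter -> R) :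
  \sum_(w : n.-bseq letter | weight w == n) F w = \sum_(w <- fib_words n) F w.
Proof.
rewrite -big_filter -(big_map val xpredT); apply: perm_big; apply: uniq_perm.
- by rewrite (map_inj_uniq val_inj) filter_uniq // index_enum_uniq.
- exact: fib_words_uniq.
move=> w; rewrite mem_fib_words; apply/mapP/idP => [[v]|wn].
  by rewrite mem_filter => /andP[vn _] ->.
have sz : (size w <= n)%N by rewrite -(eqP wn) size_le_weight.
by exists (Bseq sz) => //; rewrite mem_filter wn mem_index_enum.
Qed.

(** * Recurrences for the sum over words *)

Section CloneSchur.

Variable R : comNzRingType.
Implicit Types x y p q : nat -> R.

(* [shiftB x y m k] is [B_(k-1)(m)], where [B_(-1)(m) := x_(m+1)] is the value
   that extends the three-term recurrence of [B] one step down. *)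
Definition shiftB x y m k := if k is j.+1 then cloneB x y j m else x m.+1.

Lemma cloneA0 x y : cloneA x y 0 = 1.
Proof. exact: det_mx00. Qed.

Lemma cloneA1 x y : cloneA x y 1 = x 1.
Proof. by rewrite /cloneA det_mx11 mxE. Qed.

Lemma cloneA_rec x y n :
  cloneA x y n.+2 = x n.+2 * cloneA x y n.+1 - y n.+1 * cloneA x y n.
Proof. exact: det_tridiag_mx_rec. Qed.

Lemma shiftB1 x y m : shiftB x y m 1 = y m.+1.
Proof. by rewrite /= /cloneB det_mx11 mxE /= addn1. Qed.

Lemma shiftB_rec x y m k :
  shiftB x y m k.+2 =
    x (m + k + 3)%N * shiftB x y m k.+1 - y (m + k + 2)%N * shiftB x y m k.
Proof.
rewrite /= {1}/cloneB det_tridiag_mx_rec /=; congr (_ * _ - _).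
  by congr x; lia.
case: k => [|k] /=; last by congr (y _ * _); lia.
(* For [k = 0] the exceptional superdiagonal entry x_(m+1) y_(m+2) is y_(m+2) B_(-1)(m). *)
by rewrite det_mx00 mulr1 addn0 mulrC addn1.
Qed.

Definition cauchy_sum x y p q k n :=
  \sum_(w <- fib_words n) clone_schur_rec p q k w * clone_schur_rec x y k w.

Lemma cauchy_sumSS x y p q k n :
  cauchy_sum x y p q k n.+2 =
    cauchy_sum x y p q k.+1 n.+1
    + cloneB p q k n * cloneB x y k n * cauchy_sum x y p q 0 n.
Proof.
rewrite /cauchy_sum big_cat !big_map /=; congr (_ + _).
rewrite mulr_sumr; apply: eq_big_seq => w.
by rewrite mem_fib_words => /eqP ->; rewrite mulrACA.
Qed.

(** Sorts the words by the weight [m] of what follows the first [Two]; that letter is preceded by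
    [n - 2 - m] ones, besides the [k] already read. *)
Lemma cauchy_sum_split x y p q k n :
  cauchy_sum x y p q k n =
    cloneA p q (k + n) * cloneA x y (k + n)
    + \sum_(m < n.-1) shiftB p q m (k + (n.-1 - m)) * shiftB x y m (k + (n.-1 - m))
                      * cauchy_sum x y p q 0 m.
Proof.
elim: n k => [|[|n] IHn] k.
- by rewrite /cauchy_sum big_seq1 big_ord0 addr0 addn0.
- by rewrite /cauchy_sum big_seq1 big_ord0 addr0 addn1.
rewrite cauchy_sumSS IHn /= big_ord_recr /= addrA; congr (_ + _ + _).
- by rewrite addSnnS.
- by apply: eq_bigr => m _; rewrite (subSn (ltnW (ltn_ord m))) addnS.
- by rewrite subSnn addn1.
Qed.

(** The [x], [y] factors belong to weight [n.+1], the [p], [q] factors to weight [n]; at [m = n - 1]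
    the latter is B_(-1)(n-1) = p_n. *)
Definition cross_sum x y p q n :=
  cloneA x y n.+1 * cloneA p q n
  + \sum_(m < n) shiftB x y m (n - m) * shiftB p q m (n - m).-1
                 * cauchy_sum x y p q 0 m.

Lemma cauchy_sumC x y p q k n : cauchy_sum x y p q k n = cauchy_sum p q x y k n.
Proof. by apply: eq_bigr => w _; rewrite mulrC. Qed.

(** The coefficients do not depend on [m], so the recurrence can be pulled out of sums over [m]. *)
Lemma shiftB_last x y n m (lt_mn : (m < n)%N) :
  shiftB x y m (n.+1 - m) =
    x n.+2 * shiftB x y m (n - m) - y n.+1 * shiftB x y m (n - m).-1.
Proof.
have [k ->] : exists k, n = (m + k.+1)%N by exists (n - m).-1; lia.
have -> : (m + k.+1 - m = k.+1)%N by lia.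
have -> : ((m + k.+1).+1 - m = k.+2)%N by lia.
by rewrite shiftB_rec; congr (x _ * _ - y _ * _); lia.
Qed.

(** Only the leading [x], [y] factor is expanded; its lagging part gives the cross sum with the two
    pairs exchanged. The last term is the summand [m = n], which the recurrence does not reach. *)
Lemma cross_sumS x y p q n :
  cross_sum x y p q n.+1 =
    x n.+2 * cauchy_sum x y p q 0 n.+1 - y n.+1 * cross_sum p q x y n
    + y n.+1 * p n.+1 * cauchy_sum x y p q 0 n.
Proof.
rewrite (cauchy_sum_split _ _ _ _ 0 n.+1) /cross_sum add0n big_ord_recr /=.
rewrite subSnn shiftB1 /= cloneA_rec.
under eq_bigr => m _.
  rewrite shiftB_last // subSn ?(ltnW (ltn_ord m)) //= mulrBl mulrBl.
  rewrite -!mulrA.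
  over.
rewrite sumrB -!mulr_sumr.
set s1 := \sum_(_ < n) _; set s2 := \sum_(_ < n) _.
set t1 := \sum_(_ < n) _; set t2 := \sum_(_ < n) _.
have -> : t1 = s1 by apply: eq_bigr => m _; rewrite add0n; ring.
have -> : t2 = s2 by apply: eq_bigr => m _; rewrite (cauchy_sumC p); ring.
ring.
Qed.

Lemma cauchy_sum0 x y p q : cauchy_sum x y p q 0 0 = 1.
Proof. by rewrite /cauchy_sum big_seq1 /= !cloneA0 mulr1. Qed.

(** By induction for both orders of the pairs at once, the last two terms of [cross_sumS] cancel. *)
Lemma cross_sumE x y p q n : cross_sum x y p q n = x n.+1 * cauchy_sum x y p q 0 n.
Proof.
elim: n x y p q => [|n IHn] x y p q.
  by rewrite /cross_sum big_ord0 cloneA1 cloneA0 cauchy_sum0 addr0.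
by rewrite cross_sumS IHn (cauchy_sumC p); ring.
Qed.

Lemma cauchy_sum_rec x y p q n :
  cauchy_sum x y p q 0 n.+2 =
    p n.+2 * x n.+2 * cauchy_sum x y p q 0 n.+1
    - (q n.+1 * (x n.+1 * x n.+2 - y n.+1) + y n.+1 * (p n.+1 * p n.+2 - q n.+1))
      * cauchy_sum x y p q 0 n
    + (if n is m.+1
       then p n * x n * q n.+1 * y n.+1 * cauchy_sum x y p q 0 m else 0).
Proof.
(* With both factors lagging, this is the sum for weight [n] plus the summand [m = n - 1], made of
   two values B_(-1). *)
pose lag_sum := cloneA p q n * cloneA x y n
  + \sum_(m < n) shiftB p q m (n - m).-1 * shiftB x y m (n - m).-1
                 * cauchy_sum x y p q 0 m.
have lag_sumE : lag_sum = cauchy_sum x y p q 0 n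
    + (if n is m.+1 then p n * x n * cauchy_sum x y p q 0 m else 0).
  rewrite /lag_sum (cauchy_sum_split _ _ _ _ 0 n) add0n -addrA; congr (_ + _).
  case: n {lag_sum} => [|n]; first by rewrite !big_ord0 addr0.
  rewrite big_ord_recr /= subSnn /=; congr (_ + _).
  by apply: eq_bigr => m _; rewrite subSn ?(ltnW (ltn_ord m)).
(* Multiplying the two three-term recurrences gives the first four terms; the fifth is the summand
   [m = n]. *)
have -> : cauchy_sum x y p q 0 n.+2 =
    p n.+2 * x n.+2 * cauchy_sum x y p q 0 n.+1
    - x n.+2 * q n.+1 * cross_sum x y p q n - p n.+2 * y n.+1 * cross_sum p q x y n
    + q n.+1 * y n.+1 * lag_sum + q n.+1 * y n.+1 * cauchy_sum x y p q 0 n.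
  rewrite (cauchy_sum_split _ _ _ _ 0 n.+2) (cauchy_sum_split _ _ _ _ 0 n.+1).
  rewrite !add0n /= big_ord_recr /= subSnn !shiftB1 !cloneA_rec.
  rewrite /cross_sum /lag_sum addrA; congr (_ + _).
  set t := \sum_(_ < n) _.
  set t1 := \sum_(_ < n) _; set t2 := \sum_(_ < n) _.
  set t3 := \sum_(_ < n) _; set t4 := \sum_(_ < n) _.
  have -> : t = p n.+2 * x n.+2 * t1 - x n.+2 * q n.+1 * t2
                - p n.+2 * y n.+1 * t3 + q n.+1 * y n.+1 * t4.
    rewrite !mulr_sumr -!sumrB -big_split; apply: eq_bigr => m _ /=.
    by rewrite !add0n !shiftB_last // (cauchy_sumC p); ring.
  ring.
rewrite lag_sumE !cross_sumE (cauchy_sumC p q).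
by case: n {lag_sum lag_sumE} => [|n]; ring.
Qed.

End CloneSchur.

Theorem proposition3p10 (R : comNzRingType) (x y p q : nat -> R) (n : nat) :
  \sum_(w : n.-bseq letter | weight w == n) clone_schur p q w * clone_schur x y w
  = \det (cauchy_mx x y p q n).
Proof.
rewrite (big_fib_words n (fun w => clone_schur p q w * clone_schur x y w)).
rewrite -[LHS]/(cauchy_sum x y p q 0 n).
elim/ltn_ind: n => -[|[|n]] IHn.
- by rewrite cauchy_sum0 det_mx00.
- by rewrite /cauchy_sum big_seq1 /= !cloneA1 det_mx11 mxE.
rewrite cauchy_sum_rec det_cauchy_mx_rec !IHn //.
by case: n IHn => // n IHn; rewrite IHn //; lia.
Qed.
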